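(* Let $G$ be a finite undirected graph (possibly with loops and multiple edges) with nonempty vertex set $V$ and edge set $E$, and let $b\in\mathbb{R}^V$ have all entries nonnegative. Let $u$ be a vertex of the polytope $\mathcal{P}(G,b)$. Then $|\mathrm{supp}(u)|\le|V|-B$, where $B$ is the number of bipartite components of $G$.
   Context: $\delta_G(v)$ denotes the set of edges of $G$ incident with $v$; a loop at $v$ appears once in $\delta_G(v)$. $\mathcal{P}(G,b)=\{x\in\mathbb{R}^E \mid x_e\ge 0 \text{ for each } e\in E,\ \sum_{e\in\delta_G(v)}x_e=b_v \text{ for each } v\in V\}$ (when $E=\emptyset$, $\mathbb{R}^\emptyset=\{0\}$, so it is $\{0\}$ if $b=0$ and $\emptyset$ otherwise). For $x\in\mathbb{R}^E$, $\mathrm{supp}(x)=\{e\in E\mid x_e\neq0\}$. A graph with loops is bipartite if and only if it has no odd-length cycle, where a vertex with a loop is a cycle of length 1 and two distinct parallel edges between two distinct vertices form a cycle of length 2; in particular an isolated vertex (with no loop) is a bipartite component. *)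

(* Defs.v *)
From HB Require Import structures.
From mathcomp Require Import all_boot all_order all_algebra.
From mathcomp Require Import boolp classical_sets reals.

Set Implicit Arguments.
Unset Strict Implicit.
Unset Printing Implicit Defensive.

Import Order.TTheory GRing.Theory Num.Theory.

Local Open Scope ring_scope.

(* The two ends of an edge form an unordered set, which is a singleton exactly
   when the edge is a loop; distinct edges may have the same ends. *)
Record multigraph := Multigraph {
  vertex : finType;
  edge : finType;
  ends : edge -> {set vertex};
  card_ends : forall e, (0 < #|ends e| <= 2)%N
}.

Section Graph.
Variable G : multigraph.

(* As a set of edges, so a loop at v occurs once. *)
Definition delta (v : vertex G) : {set edge G} := [set e | v \in ends e].

Definition adjacent : rel (vertex G) :=
  fun v w => [exists e : edge G, ends e == [set v; w]].

Definition components : {set {set vertex G}} :=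
  equivalence_partition (connect adjacent) [set: vertex G].

(* ordS is the cyclic successor on 'I_k: the edge e i joins v i to v (i + 1),
   indices modulo k.  For k = 1 this is a vertex with a loop, and for k = 2 two
   distinct parallel edges between two distinct vertices. *)
Definition is_cycle k (v : 'I_k -> vertex G) (e : 'I_k -> edge G) : Prop :=
  [/\ (0 < k)%N, injective v, injective e
    & forall i, ends (e i) = [set v i; v (ordS i)]].

Definition bipartite_on (C : {set vertex G}) : Prop :=
  forall k (v : 'I_k -> vertex G) (e : 'I_k -> edge G),
    is_cycle v e -> (forall i, v i \in C) -> ~~ odd k.

Definition bipartite_components : {set {set vertex G}} :=
  [set C in components | `[< bipartite_on C >]].

End Graph.

Definition polytope (R : realType) (G : multigraph) (b : {ffun vertex G -> R}) :
    set {ffun edge G -> R} :=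
  [set x : {ffun edge G -> R} | (forall e, 0 <= x e) /\
    (forall v, \sum_(e in delta v) x e = b v)]%classic.

(* A vertex of a polytope, as an extreme point: a point of P that is not a
   proper convex combination of other points of P. *)
Definition polytope_vertex (R : realType) (E : finType)
    (P : set {ffun E -> R}) (u : {ffun E -> R}) : Prop :=
  P u /\
  forall (x y : {ffun E -> R}) (t : R), P x -> P y -> 0 < t < 1 ->
    (forall e, u e = t * x e + (1 - t) * y e) -> x = u /\ y = u.

Definition supp (R : realType) (E : finType) (x : {ffun E -> R}) : {set E} :=
  [set e | x e != 0].

(* Main.v *)
(* The rows of the edge-vertex incidence matrix indexed by supp u are linearly
   independent: a linear relation d between them is supported in supp u, so
   u + a d and u - a d both lie in the polytope for small a > 0, and
   extremality of u forces d = 0.  On the other side, each bipartite component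
   has a proper 2-colouring, and the corresponding +1/-1 vector supported on
   the component is orthogonal to all rows.  These vectors have disjoint
   supports, so rank-nullity gives |supp u| + B <= |V|. *)
Require Import Defs.
From HB Require Import structures.
From mathcomp Require Import all_boot all_order all_algebra.
From mathcomp Require Import boolp classical_sets reals.
From mathcomp Require Import zify ring.

Set Implicit Arguments.
Unset Strict Implicit.
Unset Printing Implicit Defensive.

Import Order.TTheory GRing.Theory Num.Theory.

Local Open Scope ring_scope.

(** * Odd closed walks and 2-colourings of bipartite components *)

Section Graph.
Variable G : multigraph.
Implicit Types (v w x r : vertex G) (c p : seq (vertex G)).

Lemma adjacent_sym : symmetric (@adjacent G).
Proof. by move=> v w; apply: eq_existsb => e; rewrite finset.setUC. Qed.

Lemma set2_inj_cases (T : finType) (a b c d : T) :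
  [set a; b]%SET = [set c; d]%SET -> a = c \/ (a = d /\ b = c).
Proof.
move=> E; have := set21 a b; have := set22 a b; have := set21 c d.
rewrite -{1}E !{2 3}E !inE => /orP[/eqP->|/eqP->]; first by left.
by move=> _ /orP[]/eqP->; [left | right].
Qed.

(** Two positions that are cyclic successors of each other force [k] to divide 2, hence [k = 1] when
    [k] is odd. *)
Lemma succ_mod_swap_odd k i j : (i < k)%N -> (j < k)%N -> odd k ->
  (i.+1 %% k = j)%N -> (j.+1 %% k = i)%N -> j = i.
Proof.
case: k => // n; rewrite !ltnS leq_eqVlt => /orP[/eqP->|lt_in];
  rewrite leq_eqVlt => /orP[/eqP->|lt_jn];
  rewrite ?modnn ?(@modn_small _.+1) ?ltnS //=; lia.
Qed.

(** Distinct vertices force distinct edges only because the length is odd: a closed walk on two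
    vertices may traverse one edge back and forth. *)
Lemma uniq_cycle_is_cycle x c : cycle (@adjacent G) (x :: c) ->
  uniq (x :: c) -> odd (size (x :: c)) ->
  exists e : 'I_(size (x :: c)) -> edge G,
    is_cycle (fun i : 'I_(size (x :: c)) => nth x (x :: c) i) e.
Proof.
set s := x :: c => cyc_s uniq_s odd_s.
pose v (i : 'I_(size s)) := nth x s i.
have v_inj : injective v.
  move=> i j /eqP; rewrite nth_uniq ?ltn_ord // => /eqP; exact: val_inj.
have adj i : exists e : edge G, ends e == [set v i; v (ordS i)]%SET.
  apply/existsP; rewrite -/(adjacent (v i) (v (ordS i))).
  have vi : v i \in s by rewrite mem_nth.
  suff -> : v (ordS i) = next s (v i) by exact: next_cycle.
  rewrite next_nth vi /v index_uniq //= -/s.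
  case: (ltnP i (size c)) => [lt_ic|le_ci].
    by rewrite modn_small //= ltnS.
  (* At the last position [next_nth] reads past the end of [c] and returns its default [x], the head
     of [s]; this is the wrap-around. *)
  have -> : i = size c :> nat by apply/eqP; rewrite eqn_leq le_ci -ltnS (ltn_ord i).
  by rewrite modnn [RHS]nth_default ?leqnn.
pose e i := xchoose (adj i).
have eE i : ends (e i) = [set v i; v (ordS i)]%SET by apply/eqP; exact: (xchooseP (adj i)).
exists e; split=> // i j eij.
have := eE i; rewrite eij eE => /set2_inj_cases[/v_inj //|[/v_inj ji /v_inj ij]].
apply: val_inj; move/(congr1 val): ij; move/(congr1 val): ji => /=.
by move=> ji ij; exact: (succ_mod_swap_odd (ltn_ord j) (ltn_ord i) odd_s ij (esym ji)).
Qed.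

(* A repeated vertex splits an odd closed walk into two shorter closed walks,
   one of which is odd. *)
Lemma bipartite_on_no_odd_closed_walk (C : {set vertex G}) :
  bipartite_on C -> forall c, cycle (@adjacent G) c -> {subset c <= C} ->
  ~~ odd (size c).
Proof.
move=> bipC c; have [n] := ubnP (size c); elim: n c => // n IHn c le_cn cyc_c sub_c.
case: (boolP (uniq c)) => [uniq_c|].
  case: c => // x c in cyc_c sub_c uniq_c le_cn *; apply/negP => odd_c.
  have [e cyc_e] := uniq_cycle_is_cycle cyc_c uniq_c odd_c.
  have /negP := bipC _ _ _ cyc_e (fun i => sub_c _ (mem_nth x (ltn_ord i))).
  exact.
case: c => // x0 c0 in le_cn cyc_c sub_c *; move: (x0 :: c0) => c in le_cn cyc_c sub_c *.
case/(uniqPn x0) => i [j [lt_ij lt_jc eq_ij]].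
have lt_ic := ltn_trans lt_ij lt_jc.
have [x [s1 [s2 [s3 Ec]]]] : exists x s1 s2 s3, c = s1 ++ x :: s2 ++ x :: s3.
  exists (nth x0 c i), (take i c), (take (j - i.+1) (drop i.+1 c)), (drop j.+1 c).
  rewrite {2}eq_ij -(drop_nth x0 lt_jc).
  have -> : drop j c = drop (j - i.+1) (drop i.+1 c) by rewrite drop_drop subnK.
  by rewrite cat_take_drop -(drop_nth x0 lt_ic) cat_take_drop.
(* Rotated to start at the first [x], the walk splits at the second one into [x :: s2] and
   [x :: s3 ++ s1], whose lengths add up to the original length. *)
move: cyc_c sub_c le_cn; rewrite {}Ec.
rewrite -(rot_cycle (size s1)) rot_size_cat => cyc_c sub_c.
move: cyc_c; rewrite /= -catA rcons_cat cat_path /= => /and3P[p2 l2 p3].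
have cyc2 : cycle (@adjacent G) (x :: s2) by rewrite /= rcons_path p2 l2.
have cyc3 : cycle (@adjacent G) (x :: s3 ++ s1) by [].
rewrite size_cat /= size_cat /= => le_cn.
have sub2 : {subset x :: s2 <= C}.
  by move=> y yin; apply: sub_c; move: yin; rewrite !(mem_cat, inE) => /orP[]->; rewrite ?orbT.
have sub3 : {subset x :: s3 ++ s1 <= C}.
  by move=> y yin; apply: sub_c; move: yin; rewrite !(mem_cat, inE) => /or3P[]->; rewrite ?orbT.
have := IHn _ _ cyc2 sub2; have := IHn _ _ cyc3 sub3.
rewrite /= size_cat; lia.
Qed.

(** Colour a vertex by whether an even walk from [r] reaches it. Even walks to both ends of an edge
    would close up to an odd closed walk; if one end has no even walk, its walk from [r] is odd and
    the edge extends it to an even walk to the other end. *)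
Lemma bipartite_on_component_coloring r :
  bipartite_on [set w | connect (@adjacent G) r w]%SET ->
  exists col : vertex G -> bool, forall v w, connect (@adjacent G) r v ->
    adjacent v w -> col v != col w.
Proof.
set C := [set w | _]%SET => bipC.
pose even_walk v := exists p, [/\ path (@adjacent G) r p, last r p = v & ~~ odd (size p)].
exists (fun v => `[< even_walk v >]) => v w r_v vw.
case: asboolP => [[p1 [path1 last1 even1]]|no_v];
  case: asboolP => [[p2 [path2 last2 even2]]|no_w] //.
  (* Out along [p1], across the edge, back along [p2]. The initial [r] is left out and the final one
     kept, so [q] lists each step of the closed walk once. *)
  pose q := p1 ++ w :: rev (belast r p2).
  have path_q : path (@adjacent G) r q.
    rewrite cat_path path1 last1 /= vw -last2 rev_path.
    by rewrite (eq_path (e' := @adjacent G)) // => a b; rewrite adjacent_sym.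
  have last_q : last r q = r.
    rewrite last_cat /=; case: (p2) last2 => //= y p2' _.
    by rewrite rev_cons last_rcons.
  have cyc_q : cycle (@adjacent G) q.
    move: path_q last_q; rewrite /q; case/lastP: (_ ++ _) => // q' z path_q.
    rewrite last_rcons => Ez; rewrite {}Ez in path_q *.
    by rewrite -cats1 -(rot_cycle (size q')) rot_size_cat.
  have sub_q : {subset q <= C}.
    by move=> y yq; rewrite inE; apply: (path_connect path_q); rewrite inE yq orbT.
  have := bipartite_on_no_odd_closed_walk bipC cyc_q sub_q.
  rewrite size_cat /= size_rev size_belast addnS /= negbK oddD.
  by rewrite (negbTE even1) (negbTE even2).
case/connectP: r_v => p path_p Ev; case: no_w.
exists (rcons p w); rewrite rcons_path path_p -Ev vw last_rcons size_rcons; split=> //=.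
by rewrite negbK; apply/negPn/negP => even_p; apply: no_v; exists p.
Qed.

Lemma bipartite_component_coloring (C : {set vertex G}) :
  C \in bipartite_components G -> exists col : vertex G -> bool,
  forall v w, adjacent v w -> (v \in C) = (w \in C) /\ (v \in C -> col v != col w).
Proof.
rewrite inE => /andP[/imsetP[r _ ->] /asboolP].
have -> : [set y in [set: vertex G]%SET | connect (@adjacent G) r y]%SET
    = [set y | connect (@adjacent G) r y]%SET by apply/setP => y; rewrite !inE.
move=> /bipartite_on_component_coloring[col colP]; exists col => v w vw.
rewrite !inE; split; last by move=> r_v; exact: colP.
by apply: same_connect_r; [exact: sym_connect_sym adjacent_sym | exact: connect1].
Qed.

Lemma components_partition : finset.partition (components G) [set: vertex G]%SET.
Proof.
apply: equivalence_partitionP => v w x _ _ _; split=> [|vw]; first exact: connect0.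
by apply: same_connect => //; exact: sym_connect_sym adjacent_sym.
Qed.

Lemma ends_pair (e : edge G) : exists v w, ends e = [set v; w]%SET.
Proof.
have /andP[gt0 le2] := card_ends e; case: (ltnP #|ends e| 2) => [lt2|ge2].
  have /cards1P[v Ev] : #|ends e| == 1%N by rewrite eqn_leq -ltnS lt2.
  by exists v, v; rewrite finset.setUid.
have /cards2P[v [w [_ ->]]] : #|ends e| == 2%N by rewrite eqn_leq le2.
by exists v, w.
Qed.

End Graph.

(** * Ranks of the incidence and colouring matrices *)

Section Incidence.
Variables (R : realType) (G : multigraph).

Definition incidence_mx (A : {set edge G}) : 'M[R]_(#|A|, #|vertex G|) :=
  \matrix_(i, j) (enum_val j \in ends (enum_val i))%:R.

Lemma polytope_vertex_row_free (b : {ffun vertex G -> R}) (u : {ffun edge G -> R}) :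
  polytope_vertex (polytope b) u -> row_free (incidence_mx (supp u)).
Proof.
case=> -[u_ge0 u_sum] u_ext; apply: inj_row_free => c cA0.
(* The relation [c], extended by zero from the support to all edges. *)
pose d (e : edge G) : R := \sum_(i | enum_val i == e) c 0 i.
have d_val i : d (enum_val i) = c 0 i.
  rewrite /d (big_pred1 i) // => j /=; exact/inj_eq/enum_val_inj.
have d_supp e : u e = 0 -> d e = 0.
  move=> ue0; rewrite /d big_pred0 // => i; apply/negP => /eqP ie.
  by have := enum_valP i; rewrite ie inE ue0 eqxx.
have d_sum v : \sum_(e in delta v) d e = 0.
  have /rowP/(_ (enum_rank v)) := cA0; rewrite !mxE; apply: etrans.
  rewrite /d (exchange_big_dep predT) //=; apply: eq_bigr => i _.
  rewrite mxE enum_rankK; have [vi|vi] := boolP (v \in ends _).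
    rewrite mulr1 (big_pred1 (enum_val i)) // => e.
    by rewrite inE /= [RHS]eq_sym; case: eqP => [<-|]; rewrite ?vi ?andbF.
  rewrite mulr0 big_pred0 // => e; rewrite inE.
  by case: eqP => [<-|]; rewrite ?(negbTE vi) ?andbF.
(* Moving from u by d / q in either direction keeps all entries nonnegative. *)
pose q := 1 + \sum_(e in supp u) `|d e| / u e.
have term_ge0 e : 0 <= `|d e| / u e by rewrite divr_ge0.
have q_gt0 : 0 < q by rewrite ltr_pwDl // sumr_ge0.
(* On the support [q] dominates each ratio of [|d e|] to [u e]; its summand 1 makes it positive even
   if the sum vanishes. *)
have d_le e : `|q^-1 * d e| <= u e.
  have [ue0|ue_neq0] := eqVneq (u e) 0; first by rewrite d_supp // mulr0 normr0 ue0.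
  have ue_gt0 : 0 < u e by rewrite lt_def ue_neq0 u_ge0.
  rewrite normrM gtr0_norm ?invr_gt0 // mulrC ler_pdivrMr // mulrC -ler_pdivrMr //.
  rewrite /q (bigD1 e) /=; last by rewrite inE.
  by rewrite addrCA lerDl addr_ge0 ?sumr_ge0.
pose shift (a : R) : {ffun edge G -> R} := [ffun e => u e + a * (q^-1 * d e)].
have shiftP a : `|a| = 1 -> polytope b (shift a).
  move=> a1; split=> [e|v]; last first.
    under eq_bigr do rewrite ffunE mulrA.
    by rewrite big_split /= u_sum -mulr_sumr d_sum mulr0 addr0.
  rewrite ffunE -lerBlDl sub0r; have := d_le e.
  by rewrite -[X in X <= _]mul1r -a1 -normrM ler_norml => /andP[].
have [||||shift_u _] := u_ext (shift 1) (shift (-1)) 2^-1.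
- by apply: shiftP; rewrite normr1.
- by apply: shiftP; rewrite normrN1.
- by rewrite invr_gt0 ltr0n invf_lt1 ?ltr1n ?ltr0n.
- by move=> e; rewrite !ffunE; field; rewrite gt_eqF.
apply/rowP => i; rewrite mxE -d_val; apply/eqP.
move/ffunP/(_ (enum_val i)): shift_u; rewrite ffunE mul1r -[RHS]addr0 => /addrI/eqP.
by rewrite mulf_eq0 invr_eq0 (gt_eqF q_gt0).
Qed.

Definition coloring_mx (P : {set {set vertex G}})
    (col : {set vertex G} -> vertex G -> bool) : 'M[R]_(#|P|, #|vertex G|) :=
  \matrix_(i, j) ((enum_val j \in (enum_val i : {set vertex G}))%:R
                  * (-1) ^+ col (enum_val i) (enum_val j)).

(** At a vertex of a block, only the row of that block is nonzero, so a linear relation evaluated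
    there isolates its coefficient up to sign. *)
Lemma coloring_mx_row_free (P : {set {set vertex G}}) col :
  finset.trivIset P -> finset.set0 \notin P -> row_free (coloring_mx P col).
Proof.
move=> /finset.trivIsetP tiP P_neq0; apply: inj_row_free => c cS0; apply/rowP => i.
have Pi := enum_valP i.
have /finset.set0Pn[v vi] : enum_val i != finset.set0.
  by apply: contraNneq P_neq0 => <-.
have /rowP/(_ (enum_rank v)) := cS0; rewrite !mxE (bigD1 i) //= big1 => [|j ji].
  rewrite mxE enum_rankK vi mul1r addr0 => /eqP.
  by rewrite mulf_eq0 signr_eq0 orbF => /eqP.
rewrite mxE enum_rankK; have [vj|] := boolP (v \in enum_val j); last by rewrite mul0r mulr0.
have neq_ji : enum_val j != enum_val i by rewrite (inj_eq enum_val_inj).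
have := tiP _ _ (enum_valP j) Pi neq_ji.
by move/disjointFr => /(_ v vj); rewrite vi.
Qed.

(** An edge lies wholly inside or wholly outside a block. Inside, its ends have different colours,
    so it is not a loop and its two signs cancel. *)
Lemma incidence_mx_coloring_mx (A : {set edge G}) (P : {set {set vertex G}}) col :
  (forall C, C \in P -> forall v w, adjacent v w ->
    (v \in C) = (w \in C) /\ (v \in C -> col C v != col C w)) ->
  incidence_mx A *m (coloring_mx P col)^T = 0.
Proof.
move=> colP; apply/matrixP => i j; rewrite !mxE.
under eq_bigr do rewrite !mxE.
have {colP} := colP _ (enum_valP j); move: (enum_val j) => C colP.
rewrite (reindex enum_rank) /=; last by apply: onW_bij; exact: enum_rank_bij.
under eq_bigr do rewrite enum_rankK.
set e := enum_val i; have [v [w Evw]] := ends_pair e.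
have [|same_C col_neq] := colP v w; first by apply/existsP; exists e; rewrite Evw.
rewrite Evw; have [vC|vC] := boolP (v \in C); last first.
  rewrite big1 // => x _; rewrite !inE.
  have [->|_] := eqVneq x v; first by rewrite (negbTE vC) mul0r mulr0.
  have [->|_] := eqVneq x w; last by rewrite mul0r.
  by rewrite -same_C (negbTE vC) mul0r mulr0.
have {}col_neq := col_neq vC.
have vw : v != w by apply: contraNneq col_neq => ->.
rewrite (bigD1 v) // (bigD1 w) 1?eq_sym //= big1 => [|x /andP[/negbTE xv /negbTE xw]].
  rewrite !inE !eqxx orbT -same_C vC !mul1r addr0.
  by move: col_neq; case: (col C v); case: (col C w) => //=; rewrite ?addrN ?addNr.
by rewrite !inE xv xw mul0r.
Qed.

End Incidence.

Theorem corollary21 (R : realType) (G : multigraph)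
    (V_nonempty : (0 < #|vertex G|)%N)
    (b : {ffun vertex G -> R}) (b_ge0 : forall v, 0 <= b v)
    (u : {ffun edge G -> R}) (u_vertex : polytope_vertex (polytope b) u) :
  #|supp u|%:Z <= #|vertex G|%:Z - #|bipartite_components G|%:Z.
Proof.
have /choice[col colP] : forall C, exists col : vertex G -> bool,
    C \in bipartite_components G -> forall v w, adjacent v w ->
    (v \in C) = (w \in C) /\ (v \in C -> col v != col w).
  (* Sets that are not bipartite components get an arbitrary colouring, so that the choice is
     total. *)
  move=> C; have [|_] := boolP (C \in bipartite_components G); last by exists xpredT.
  by case/bipartite_component_coloring => col; exists col.
have [_ tiP P_neq0] := and3P (components_partition G).
have sub_P : bipartite_components G \subset components G.
  by apply/fintype.subsetP => C; rewrite inE => /andP[].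
(* A zero product bounds the sum of the two ranks by the inner dimension, the number of vertices;
   both ranks are full. *)
have := mulmx0_rank_max (incidence_mx_coloring_mx R (supp u) colP).
rewrite mxrank_tr (eqP (polytope_vertex_row_free u_vertex)).
rewrite (eqP (coloring_mx_row_free R col _ _)).
- by rewrite lerBrDr -PoszD lez_nat.
- exact: finset.trivIsetS sub_P tiP.
- by apply: contra P_neq0 => /(fintype.subsetP sub_P).
Qed.
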